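(* Let $\mathcal C$ be the convex cone of all real symmetric positive semidefinite $6\times 6$ matrices $A=(a_{ij})_{i,j=1}^6$ satisfying $$a_{14}=a_{22},\quad a_{15}=a_{23},\quad a_{16}=a_{33},\quad a_{25}=a_{34},\quad a_{26}=a_{35},\quad a_{46}=a_{55}.$$ For $x,y,z\in\mathbb R$ let $v(x,y,z)\in\mathbb R^6$ be the column vector with $$v(x,y,z)^\top=\begin{bmatrix} x^2 & xy & xz & y^2 & yz & z^2\end{bmatrix}.$$ Then every extreme ray of $\mathcal C$ is generated by a rank 1 matrix of the form $v(x,y,z)\,v(x,y,z)^\top$ for some $x,y,z\in\mathbb R$. Thus every element of $\mathcal C$ is a (finite) nonnegative linear combination of matrices $v(x,y,z)\,v(x,y,z)^\top$ with $x,y,z\in\mathbb R$.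
   Context: A (convex) cone is a set closed under addition and nonnegative scaling. The ray of a cone generated by a nonzero element $A$ of the cone is the set $\{tA: t\ge 0\}$ of all nonnegative multiples of $A$. A ray of a cone is called extreme if it cannot be expressed as a nonnegative linear combination of other rays of the cone; equivalently (for the cone $\mathcal C$ here), the ray generated by $A\neq 0$ is extreme if whenever $A=B+B'$ with $B,B'$ in the cone, both $B$ and $B'$ are nonnegative multiples of $A$. *)

(* Defs.v *)
From HB Require Import structures.
From mathcomp Require Import all_boot all_order all_algebra.
From mathcomp Require Import boolp classical_sets reals.

Set Implicit Arguments.
Unset Strict Implicit.
Unset Printing Implicit Defensive.

Import Order.TTheory GRing.Theory Num.Theory.
Local Open Scope classical_set_scope.
Local Open Scope ring_scope.

Definition convex_cone (R : realType) (V : lmodType R) (C : set V) : Prop :=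
  (forall A B, C A -> C B -> C (A + B)) /\
  (forall t A, 0 <= t -> C A -> C (t *: A)).

Definition ray (R : realType) (V : lmodType R) (A : V) : set V :=
  [set B | exists2 t : R, 0 <= t & B = t *: A].

Definition is_ray (R : realType) (V : lmodType R) (C r : set V) : Prop :=
  exists A, [/\ C A, A != 0 & r = ray A].

(* A ray is a nonnegative combination of other rays when it is generated by a
   nonnegative combination of (nonzero) generators of those rays. *)
Definition extreme_ray (R : realType) (V : lmodType R) (C r : set V) : Prop :=
  is_ray C r /\
  ~ exists (n : nat) (c : 'I_n -> R) (B : 'I_n -> V),
      [/\ forall i, 0 <= c i,
          forall i, [/\ C (B i), B i != 0 & ray (B i) <> r]
        & r = ray (\sum_(i < n) c i *: B i)].

Definition psdmx (R : realType) (n : nat) (A : 'M[R]_n) : Prop :=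
  A \is symmetricmx /\ forall u : 'cV[R]_n, 0 <= (u^T *m A *m u) 0 0.

(* Entry of a 6 x 6 matrix with rows and columns numbered from 1 to 6. *)
Definition entry (R : realType) (A : 'M[R]_6) (i j : nat) : R :=
  A (inord i.-1) (inord j.-1).

Definition coneC (R : realType) : set 'M[R]_6 :=
  [set A | psdmx A /\
     [/\ entry A 1 4 = entry A 2 2, entry A 1 5 = entry A 2 3
       & entry A 1 6 = entry A 3 3] /\
     [/\ entry A 2 5 = entry A 3 4, entry A 2 6 = entry A 3 5
       & entry A 4 6 = entry A 5 5]].

Definition v (R : realType) (x y z : R) : 'cV[R]_6 :=
  \col_(i < 6) [:: x ^+ 2; x * y; x * z; y ^+ 2; y * z; z ^+ 2]`_i.

Lemma ray_refl (R : realType) (V : lmodType R) (A : V) : ray A A.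
Proof. by exists 1; rewrite ?scale1r. Qed.

Lemma ray_scale (R : realType) (V : lmodType R) (t : R) (A : V) :
  0 < t -> ray (t *: A) = ray A.
Proof.
move=> t0; apply/seteqP; split=> B [s s0 ->].
  by exists (s * t); rewrite ?scalerA // mulr_ge0 // ltW.
exists (s / t); first by rewrite divr_ge0 // ltW.
by rewrite scalerA divfK // gt_eqF.
Qed.

(* In a pointed convex cone, extremality can be tested on two summands. *)
Lemma extreme_rayP (R : realType) (V : lmodType R) (C : set V) (A : V) :
  convex_cone C -> (forall B, C B -> C (- B) -> B = 0) -> C A -> A != 0 ->
  extreme_ray C (ray A) <->
  (forall B B', C B -> C B' -> A = B + B' -> ray A B /\ ray A B').
Proof.
move=> [CD CZ] Cpt CA A0.
have C0 : C 0 by rewrite -(scale0r A); exact: CZ.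
have ray0 D : ~ ray A D -> D != 0.
  by move=> nD; apply/eqP => D0; apply: nD; exists 0; rewrite ?scale0r.
split=> [[_ nex] | two].
- have swap D D' : C D -> C D' -> A = D + D' -> ray A D' -> ray A D.
    move=> CD0 CD' AE [t t0 D'E].
    have DE : D = (1 - t) *: A by rewrite scalerBl scale1r -D'E AE addrK.
    have [t1 | t1] := leP t 1; first by exists (1 - t); rewrite ?subr_ge0.
    have D0 : D = 0.
      apply: Cpt => //; rewrite DE -scaleNr opprB.
      by apply: CZ => //; rewrite subr_ge0 ltW.
    by exists 0; rewrite ?scale0r.
  move=> B B' CB CB' AE; have AE' : A = B' + B by rewrite addrC.
  have [rB | nB] := pselect (ray A B).
    by split=> //; exact: swap CB' CB AE' rB.
  have nB' : ~ ray A B' by move=> /(swap _ _ CB CB' AE).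
  case: nex; exists 2%N, (fun=> 1), (fun i => if i == ord0 then B else B').
  split=> [//| i |]; last first.
    by rewrite big_ord_recl big_ord1 /= !scale1r -AE.
  have neq D : ~ ray A D -> ray D <> ray A.
    by move=> nD E; apply: nD; rewrite -E; exact: ray_refl.
  by case: ifP => _; split=> //; [exact: ray0|exact: neq|exact: ray0|exact: neq].
- split; first by exists A.
  move=> [n [c [B [c0 HB rE]]]].
  have [t t0 AE] : ray (\sum_(i < n) c i *: B i) A by rewrite -rE; exact: ray_refl.
  have {}AE : A = \sum_(i < n) (t * c i) *: B i.
    by rewrite {1}AE scaler_sumr; apply: eq_bigr => i _; rewrite scalerA.
  have [i ti] : exists i, t * c i != 0.
    apply: contrapT => no; case/eqP: A0; rewrite AE big1 // => i _.
    by have [->|tn] := eqVneq (t * c i) 0; [rewrite scale0r | case: no; exists i].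
  have [CBi Bi0 nBi] := HB i.
  have tc j : 0 <= t * c j by rewrite mulr_ge0.
  have Crest : C (\sum_(j < n | j != i) (t * c j) *: B j).
    by apply: big_ind => // j _; apply: CZ => //; case: (HB j).
  rewrite (bigD1 i) //= in AE.
  have [[s s0 sE] _] := two _ _ (CZ _ _ (tc i) CBi) Crest AE.
  apply: nBi; rewrite -(@ray_scale _ _ (t * c i)) ?lt_neqAle 1?eq_sym ?ti ?tc //.
  rewrite sE ray_scale // lt_neqAle s0 andbT eq_sym.
  apply/eqP => s00; move: sE; rewrite s00 scale0r => /eqP.
  by rewrite scaler_eq0 (negbTE ti) (negbTE Bi0).
Qed.

Lemma coneC_convex (R : realType) : convex_cone (@coneC R).
Proof.
split=> [A B | t A t0].
- move=> [[sA pA] [[a1 a2 a3] [a4 a5 a6]]] [[sB pB] [[b1 b2 b3] [b4 b5 b6]]].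
  split; [split|by rewrite /entry !mxE; move: a1 a2 a3 a4 a5 a6 b1 b2 b3 b4 b5 b6;
    rewrite /entry => -> -> -> -> -> -> -> -> -> -> -> ->].
    move: sA sB => /is_hermitianmxP sA /is_hermitianmxP sB.
    by apply/is_hermitianmxP; rewrite raddfD map_mxD scalerDr -sA -sB.
  by move=> u; rewrite mulmxDr mulmxDl mxE addr_ge0.
- move=> [[sA pA] [[a1 a2 a3] [a4 a5 a6]]].
  split; [split|by rewrite /entry !mxE; move: a1 a2 a3 a4 a5 a6;
    rewrite /entry => -> -> -> -> -> ->].
    move: sA => /is_hermitianmxP sA; apply/is_hermitianmxP.
    by rewrite [in LHS]sA; apply/matrixP => i j; rewrite !mxE /= !expr0 !mul1r.
  by move=> u; rewrite -scalemxAr -scalemxAl mxE mulr_ge0.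
Qed.

Lemma coneC_pointed (R : realType) (A : 'M[R]_6) :
  coneC A -> coneC (- A) -> A = 0.
Proof.
move=> [[sA pA] _] [[_ nA] _].
have q0 (u : 'cV[R]_6) : (u^T *m A *m u) 0 0 = 0.
  apply/eqP; rewrite eq_le pA andbT -oppr_ge0.
  by have := nA u; rewrite mulmxN mulNmx mxE.
have sym i j : A j i = A i j.
  move: sA => /is_hermitianmxP /matrixP /(_ i j).
  by rewrite !mxE /= expr0 mul1r => ->.
have qE i j : ((delta_mx i 0)^T *m A *m delta_mx j 0 : 'M_1) 0 0 = A i j.
  by rewrite trmx_delta -rowE -colE !mxE.
apply/matrixP => i j; rewrite [RHS]mxE.
have := q0 (delta_mx i 0 + delta_mx j 0).
rewrite [(_ + _)^T]raddfD /= !mulmxDl !mulmxDr.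
rewrite [X in X = _]mxE [X in X + _]mxE [X in _ + X]mxE.
rewrite !qE -(qE i i) -(qE j j) !q0 add0r addr0 sym -mulr2n => /eqP.
by rewrite mulrn_eq0 /= => /eqP.
Qed.

(* Main.v *)
Require Import Defs.
From HB Require Import structures.
From mathcomp Require Import all_boot all_order all_algebra.
From mathcomp Require Import boolp classical_sets reals.
From mathcomp Require Import ring lra.

(** An element of the cone is the moment matrix of a linear functional [L] on
    ternary quartic forms, [A (f, g) = L (f g)] for quadratic monomials [f],
    [g], and [v(P) v(P)^T] is the moment matrix of the evaluation at [P].
    Everything follows from one claim: the range of a nonzero [A] in the cone
    contains some [v(P) != 0] ([coneC_has_point]).  Indeed one may then subtract
    from [A] a positive multiple of [v(P) v(P)^T] so as to stay in the cone and
    to lower the rank ([coneC_subtract_point]); this gives the decomposition by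
    induction on the rank, and if [A] spans an extreme ray, then
    [v(P) v(P)^T] lies on that ray.

    To prove the claim, write [A = Y Y^T] with [Y] of full column rank [r]
    ([gram_factor]) and read [Y] as a linear map from quadratic forms to [R^r].
    Matrices [Y S Y^T] have their range inside that of [A].  If some of them, with
    [S != 0] symmetric and traceless, satisfies the linear equations of a
    moment matrix, then on the half-line [A + t Y S Y^T], [t >= 0], the last point
    of the cone has smaller rank ([psdmx_exit]), and induction applies.
    Otherwise only scalar [S] give moment matrices, which is very restrictive.

    - Counting dimensions, [r <= 3] ([moment_sandwich]).
    - If [q |-> Y (l q)] maps linear forms onto [R^r] for some linear form [l],
      the multiplications by the variables induce commuting symmetric
      endomorphisms of [R^r].  These are admissible choices of [S], hence they
      are scalars, and the three scalars are the coordinates of [P]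
      ([flat_point]).
    - If [Y (p q) = 0] for some [p != 0] and all [q], the functional is carried by
      the line [p = 0]; either the previous case applies, or a functional
      vanishing on the multiples of [p] and of a second form [l] provides the
      point [p = l = 0] ([degenerate_point]).
    - If there is no such [p], some [q |-> Y (l q)] is injective
      ([mulform_free]), and as [r <= 3] it is onto. *)

Set Implicit Arguments.
Unset Strict Implicit.
Unset Printing Implicit Defensive.

Import Order.TTheory GRing.Theory Num.Theory.
Local Open Scope classical_set_scope.
Local Open Scope ring_scope.

(** * Positive semidefinite matrices *)

Lemma psdmxP (R : realType) n (A : 'M[R]_n) :
  psdmx A <-> A^T = A /\ forall u : 'cV[R]_n, 0 <= (u^T *m A *m u) 0 0.
Proof.
have idE (B : 'M[R]_n) : map_mx idfun B = B by apply/matrixP => i j; rewrite mxE.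
split=> -[sA pA]; split=> //.
  by move/is_hermitianmxP: sA; rewrite expr0 scale1r idE => <-.
by apply/is_hermitianmxP; rewrite expr0 scale1r idE sA.
Qed.

Lemma sqnormE (R : realType) n (u : 'cV[R]_n) : (u^T *m u) 0 0 = \sum_i u i 0 ^+ 2.
Proof. by rewrite mxE; apply: eq_bigr => i _; rewrite mxE. Qed.

Lemma sqnorm_ge0 (R : realType) n (u : 'cV[R]_n) : 0 <= (u^T *m u) 0 0.
Proof. by rewrite sqnormE sumr_ge0 // => i _; rewrite sqr_ge0. Qed.

Lemma sqnorm_eq0 (R : realType) n (u : 'cV[R]_n) : ((u^T *m u) 0 0 == 0) = (u == 0).
Proof.
apply/idP/eqP => [|->]; last by rewrite mulmx0 mxE.
rewrite sqnormE psumr_eq0 => [/allP u0|i _]; last by rewrite sqr_ge0.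
apply/colP => i; rewrite mxE; apply/eqP.
by have := u0 i; rewrite mem_index_enum sqrf_eq0; apply.
Qed.

Lemma sqnorm_gt0 (R : realType) n (u : 'cV[R]_n) : (0 < (u^T *m u) 0 0) = (u != 0).
Proof. by rewrite lt_neqAle eq_sym sqnorm_eq0 sqnorm_ge0 andbT. Qed.

Lemma psdmx_congr (R : realType) m n (Y : 'M[R]_(m, n)) (S : 'M[R]_n) :
  psdmx S -> psdmx (Y *m S *m Y^T).
Proof.
move=> /psdmxP [sS pS]; apply/psdmxP; split.
  by rewrite !trmx_mul trmxK sS mulmxA.
move=> u; have := pS (Y^T *m u).
by rewrite trmx_mul trmxK !mulmxA.
Qed.

Lemma psdmx1 (R : realType) n : psdmx (1%:M : 'M[R]_n).
Proof. by apply/psdmxP; rewrite trmx1; split=> // u; rewrite mulmx1 sqnorm_ge0. Qed.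

Lemma quadratic_form_line (R : realType) n (M S : 'M[R]_n) t (u : 'cV[R]_n) :
  (u^T *m (M + t *: S) *m u) 0 0 =
  (u^T *m M *m u) 0 0 + t * (u^T *m S *m u) 0 0.
Proof. by rewrite mulmxDr mulmxDl -scalemxAr -scalemxAl mxE [X in _ + X]mxE. Qed.

(** Polarization: the entries of [A] are recovered from the values of the
    quadratic form on the basis vectors and their pairwise sums. *)
Lemma quadratic_form_eq0 (R : realType) n (A : 'M[R]_n) :
  A^T = A -> (forall u : 'cV[R]_n, (u^T *m A *m u) 0 0 = 0) -> A = 0.
Proof.
move=> sA q0.
have qE i j : ((delta_mx i 0)^T *m A *m delta_mx j 0 : 'M_1) 0 0 = A i j.
  by rewrite trmx_delta -rowE -colE !mxE.
apply/matrixP => i j; rewrite [RHS]mxE.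
have := q0 (delta_mx i 0 + delta_mx j 0).
rewrite [(_ + _)^T]raddfD /= !mulmxDl !mulmxDr.
rewrite [X in X = _]mxE [X in X + _]mxE [X in _ + X]mxE.
rewrite !qE -(qE i i) -(qE j j) !q0 add0r addr0.
have -> : A j i = A i j by rewrite -[in LHS]sA mxE.
by move/eqP; rewrite -mulr2n mulrn_eq0 /= => /eqP.
Qed.

Lemma gram_mul_eq0 (R : realType) m n (Y : 'M[R]_(m, n)) (u : 'cV[R]_m) :
  Y *m Y^T *m u = 0 -> Y^T *m u = 0.
Proof.
move=> Yu; apply/eqP; rewrite -sqnorm_eq0 trmx_mul trmxK.
by rewrite mulmxA -(mulmxA _ Y) -(mulmxA u^T) Yu mulmx0 mxE.
Qed.

Lemma row_free_col_mx (F : fieldType) m n (B : 'M[F]_(m, n)) (y : 'rV[F]_n) :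
  row_free B -> ~~ (y <= B)%MS -> row_free (col_mx B y).
Proof.
move=> /eqP rB nyB; rewrite /row_free eqn_leq rank_leq_row /=.
apply: (@leq_trans (\rank B).+1); first by rewrite rB addn1.
have sB : (B <= col_mx B y)%MS by rewrite -addsmxE addsmxSl.
have sy : (y <= col_mx B y)%MS by rewrite -addsmxE addsmxSr.
apply: rank_ltmx; rewrite /ltmx sB /=; apply: contra nyB.
exact: submx_trans sy.
Qed.

(** Gaussian elimination on the quadratic form: if [u^T A u = a > 0], then
    [A - (A u) (A u)^T / a] is the congruence of [A] by the projection along
    [u]; it is again positive semidefinite and has [u] in its kernel, so that
    its rank is smaller. *)
Lemma gram_factor (R : realType) n (A : 'M[R]_n) : psdmx A ->
  exists r (Y : 'M[R]_(n, r)), row_full Y /\ A = Y *m Y^T.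
Proof.
elim: {A}(\rank A).+1 {-2}A (ltnSn (\rank A)) => // k IHk A rkA psdA.
have [sA pA] := (psdmxP A).1 psdA.
have [A0|A0] := eqVneq A 0.
  exists 0%N, 0; split; last by rewrite mul0mx.
  by rewrite /row_full mxrank0.
have [u pos] : exists u : 'cV[R]_n, 0 < (u^T *m A *m u) 0 0.
  apply: contrapT => no; case/eqP: A0; apply: quadratic_form_eq0 => // u.
  apply/eqP; rewrite eq_le pA andbT leNgt; apply/negP => ?; by apply: no; exists u.
set a := _ 0 0 in pos.
have a0 : a != 0 by rewrite gt_eqF.
have uAu : u^T *m A *m u = a%:M by rewrite [LHS]mx11_scalar.
pose w := A *m u.
have wT : w^T = u^T *m A by rewrite trmx_mul sA.
pose Q := 1%:M - a^-1 *: (w *m u^T).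
have QT : Q^T = 1%:M - a^-1 *: (u *m w^T).
  by rewrite raddfB /= trmx1 linearZ /= trmx_mul trmxK.
pose A' := A - a^-1 *: (w *m w^T).
have QA : Q *m A = A'.
  by rewrite mulmxBl mul1mx -scalemxAl -mulmxA -wT.
have A'E : A' = Q *m A *m Q^T.
  rewrite QA QT mulmxBr mulmx1 -scalemxAr mulmxA.
  suff -> : A' *m u = 0 by rewrite mul0mx scaler0 subr0.
  rewrite mulmxBl -scalemxAl -mulmxA wT uAu mul_mx_scalar scalerA mulVf //.
  by rewrite scale1r subrr.
have A'u : A' *m u = 0.
  rewrite mulmxBl -scalemxAl -mulmxA wT uAu mul_mx_scalar scalerA mulVf //.
  by rewrite scale1r subrr.
have psdA' : psdmx A' by rewrite A'E; exact: psdmx_congr.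
have sub : (A' <= A)%MS by rewrite -QA submxMl.
have nsub : ~~ (A <= A')%MS.
  apply/negP => /submxP [D AD]; case/eqP: a0.
  by rewrite /a AD -!mulmxA A'u !mulmx0 mxE.
have rkA' : (\rank A' < \rank A)%N by apply: rank_ltmx; rewrite /ltmx sub.
have [r [Y [fullY YE]]] := IHk A' (leq_trans rkA' rkA) psdA'.
exists (r + 1)%N, (row_mx Y ((Num.sqrt a)^-1 *: w)).
have AE : A = Y *m Y^T + a^-1 *: (w *m w^T) by rewrite -YE subrK.
split; last first.
  rewrite tr_row_mx mul_row_col AE linearZ /= -scalemxAl -scalemxAr scalerA.
  by rewrite -expr2 exprVn sqr_sqrtr ?ltW.
have Yu : Y^T *m u = 0 by apply: gram_mul_eq0; rewrite -YE.
have freeYT : row_free Y^T by rewrite /row_free mxrank_tr.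
rewrite /row_full -mxrank_tr tr_row_mx; apply: row_free_col_mx => //.
apply/negP; move=> /submxP [D /(congr1 (fun B => B *m u))].
rewrite -mulmxA Yu mulmx0 linearZ /= wT -scalemxAl uAu => /matrixP /(_ 0 0).
rewrite !mxE /= mulr1n.
by apply/eqP; rewrite mulf_neq0 // invr_eq0 gt_eqF // sqrtr_gt0.
Qed.

Lemma quadratic_form_lower_bound (R : realType) n (S : 'M[R]_n) :
  exists2 c : R, 0 < c &
    forall u : 'cV[R]_n, - (c * (u^T *m u) 0 0) <= (u^T *m S *m u) 0 0.
Proof.
exists (1 + \sum_i \sum_j `|S i j|).
  by rewrite ltr_pwDl // sumr_ge0 // => i _; rewrite sumr_ge0.
move=> u; set q := (u^T *m u) 0 0.
have q0 : 0 <= q by exact: sqnorm_ge0.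
have le1 i : u i 0 ^+ 2 <= q.
  rewrite /q sqnormE (bigD1 i) //= lerDl sumr_ge0 // => j _; exact: sqr_ge0.
have -> : (u^T *m S *m u) 0 0 = \sum_i \sum_j S i j * (u i 0 * u j 0).
  rewrite mxE exchange_big /=; apply: eq_bigr => j _; rewrite mxE big_distrl /=.
  by apply: eq_bigr => i _; rewrite !mxE; ring.
rewrite mulrDl mul1r opprD; apply: (@le_trans _ _ (- ((\sum_i \sum_j `|S i j|) * q))).
  by rewrite gerDr oppr_le0.
rewrite mulr_suml -sumrN; apply: ler_sum => i _.
rewrite mulr_suml -sumrN; apply: ler_sum => j _.
have uu : `|u i 0 * u j 0| <= q.
  rewrite ler_norml; move: (le1 i) (le1 j) => l1 l2.
  have := sqr_ge0 (u i 0 + u j 0); have := sqr_ge0 (u i 0 - u j 0).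
  by move=> h1 h2; apply/andP; split; nra.
apply: le_trans (_ : - `|S i j * (u i 0 * u j 0)| <= _); last first.
  by rewrite lerNl -normrN ler_norm.
by rewrite lerN2 normrM ler_wpM2l.
Qed.

(** Positive definiteness is an open condition. *)
Lemma psdmx_unit_perturb (R : realType) n (M S : 'M[R]_n) :
  psdmx M -> M \in unitmx -> S^T = S ->
  exists2 d : R, 0 < d & psdmx (M + d *: S).
Proof.
move=> psdM uM sS; have [r [X [_ ME]]] := gram_factor psdM.
have [sM _] := (psdmxP M).1 psdM.
pose Z := invmx M *m X.
have [c c0 Hc] := quadratic_form_lower_bound (Z^T *m S *m Z).
exists c^-1; first by rewrite invr_gt0.
apply/psdmxP; split; first by rewrite raddfD /= linearZ /= sM sS.
move=> u; rewrite quadratic_form_line.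
(* With z = X^T u, the two quadratic forms are |z|^2 and z^T (Z^T S Z) z. *)
pose z := X^T *m u.
have uE : u = Z *m z by rewrite /Z /z -mulmxA (mulmxA X) -ME mulKmx.
have -> : (u^T *m M *m u) 0 0 = (z^T *m z) 0 0.
  by rewrite /z trmx_mul trmxK ME !mulmxA.
have -> : (u^T *m S *m u) 0 0 = (z^T *m (Z^T *m S *m Z) *m z) 0 0.
  by rewrite {1 2}uE trmx_mul !mulmxA.
have := Hc z; move: (_ 0 0) => p; move: (_ 0 0) => q h.
rewrite -(ler_pM2l c0) mulr0 mulrDr mulrA divff ?gt_eqF // mul1r; lra.
Qed.

(** [N + c] is invertible for [c] large, so [M + N / c] remains injective. *)
Lemma row_free_perturb (R : realType) m n (M N : 'M[R]_(m, n)) :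
  row_free M -> exists2 e : R, e != 0 & row_free (M + e *: N).
Proof.
move=> /row_freeP [Q MQ].
have [c c0 Hc] := quadratic_form_lower_bound (N *m Q).
have e0 : 0 < (c + 1)^-1 by rewrite invr_gt0; lra.
exists (c + 1)^-1; first by rewrite gt_eqF.
rewrite -kermx_eq0; apply/rowV0P => u /sub_kermxP uK; apply/eqP.
rewrite -trmx_eq0 -sqnorm_eq0 trmxK.
have := quadratic_form_line 1%:M (N *m Q) (c + 1)^-1 u^T.
have -> : u^T^T *m (1%:M + (c + 1)^-1 *: (N *m Q)) *m u^T = 0.
  by rewrite trmxK -MQ scalemxAl -mulmxDl mulmxA uK !mul0mx.
rewrite mulmx1 mxE => E; have := Hc u^T; have := sqnorm_ge0 u^T.
move: E; rewrite trmxK; move: (_ 0 0) => q; move: (_ 0 0) => k E q0 h.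
have c1 : c + 1 != 0 by rewrite gt_eqF //; lra.
have : (c + 1) * q + k = 0.
  by rewrite -[k](mulVKf c1) -mulrDr -E mulr0.
by move=> E'; rewrite eq_le q0 andbT; nra.
Qed.

Lemma mxtrace_gram (R : realType) m n (Y : 'M[R]_(m, n)) :
  \tr (Y *m Y^T) = 0 -> Y = 0.
Proof.
have trE : \tr (Y *m Y^T) = \sum_i \sum_j Y i j ^+ 2.
  by apply: eq_bigr => i _; rewrite mxE; apply: eq_bigr => j _; rewrite mxE.
rewrite trE => /eqP; rewrite psumr_eq0 => [/allP H|i _]; last first.
  by rewrite sumr_ge0 // => j _; exact: sqr_ge0.
apply/matrixP => i j; rewrite mxE.
have := H i; rewrite mem_index_enum => /(_ isT).
rewrite psumr_eq0 => [/allP/(_ j)|j' _]; last exact: sqr_ge0.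
by rewrite mem_index_enum sqrf_eq0 => /(_ isT)/eqP.
Qed.

(** A traceless symmetric [S != 0] takes a negative value, so the half-line
    [1 + t S], [t >= 0], leaves the positive semidefinite cone; the last point
    at which it stays inside cannot be invertible, as invertible points are
    interior. *)
Lemma psdmx_exit (R : realType) n (S : 'M[R]_n) :
  S^T = S -> S != 0 -> \tr S = 0 ->
  exists2 t : R, psdmx (1%:M + t *: S) & 1%:M + t *: S \notin unitmx.
Proof.
move=> sS S0 trS.
have [u neg] : exists u : 'cV[R]_n, (u^T *m S *m u) 0 0 < 0.
  apply: contrapT => no.
  have psdS : psdmx S.
    apply/psdmxP; split=> // u; rewrite leNgt; apply/negP => ?; by apply: no; exists u.
  have [r [X [_ SE]]] := gram_factor psdS.
  by case/eqP: S0; move: trS; rewrite SE => /mxtrace_gram ->; rewrite mul0mx.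
have qE t (w : 'cV[R]_n) : (w^T *m (1%:M + t *: S) *m w) 0 0 =
    (w^T *m w) 0 0 + t * (w^T *m S *m w) 0 0.
  by rewrite quadratic_form_line mulmx1.
pose E : set R := [set t | 0 <= t /\ psdmx (1%:M + t *: S)].
have bound (w : 'cV[R]_n) : (w^T *m S *m w) 0 0 < 0 ->
    ubound E (- (w^T *m w) 0 0 / (w^T *m S *m w) 0 0).
  move=> wneg t [t0 /psdmxP [_ /(_ w)]]; rewrite qE => h.
  by rewrite ler_ndivlMr //; lra.
have E0 : E 0 by split=> //; rewrite scale0r addr0; exact: psdmx1.
have Ene : E !=set0 by exists 0.
have Eub : has_ubound E by eexists; exact: bound neg.
have ts0 : 0 <= sup E by exact: ub_le_sup.
have psdM : psdmx (1%:M + sup E *: S).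
  apply/psdmxP; split; first by rewrite raddfD /= linearZ /= trmx1 sS.
  move=> w; rewrite qE; have [pos|wneg] := leP 0 ((w^T *m S *m w) 0 0).
    by rewrite addr_ge0 ?sqnorm_ge0 // mulr_ge0.
  by have := ge_sup Ene (bound w wneg); rewrite ler_ndivlMr //; lra.
exists (sup E) => //; apply/negP => uM.
have [d d0 psdMd] := psdmx_unit_perturb psdM uM sS.
have : E (sup E + d).
  by split; [rewrite addr_ge0 // ltW | rewrite scalerDl addrA].
by move/(ub_le_sup Eub); rewrite gerDl leNgt d0.
Qed.

(** * Moment matrices of ternary quartics *)

(** Position of the monomial [x_i x_j] in the list
    [x^2, xy, xz, y^2, yz, z^2]. *)
Definition mono (i j : 'I_3) : 'I_6 :=
  inord (nth 0%N (nth [::] [:: [:: 0; 1; 2]; [:: 1; 3; 4]; [:: 2; 4; 5]]%N i) j).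

Lemma monoC i j : mono i j = mono j i.
Proof. by case: i => [[|[|[|]]]] //= ?; case: j => [[|[|[|]]]]. Qed.

Lemma mono_surj k : exists i j, k = mono i j.
Proof.
case: k => [[|[|[|[|[|[|//]]]]]] lt];
  [exists 0, 0|exists 0, 1|exists 0, 2%:R|exists 1, 1|exists 1, 2%:R|
   exists 2%:R, 2%:R]; by apply: val_inj; rewrite /= inordK.
Qed.

(** [A] is the moment matrix of a linear functional [L] on quartic forms:
    its entry at [x_i x_j], [x_k x_l] only depends on the product
    [x_i x_j x_k x_l]. *)
Definition moment (R : realType) (A : 'M[R]_6) :=
  forall i j k l, A (mono i j) (mono k l) = A (mono i k) (mono j l).

Lemma moment_entries (R : realType) (A : 'M[R]_6) : A^T = A ->
  moment A <->
    [/\ entry A 1 4 = entry A 2 2, entry A 1 5 = entry A 2 3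
      & entry A 1 6 = entry A 3 3] /\
    [/\ entry A 2 5 = entry A 3 4, entry A 2 6 = entry A 3 5
      & entry A 4 6 = entry A 5 5].
Proof.
move=> sA; split=> [mA|[[]]]; rewrite /entry /=; last first.
  move=> e1 e2 e3 [e4 e5 e6].
  have sym a b : A a b = A b a by rewrite -[in LHS]sA mxE.
  pose f a b := A (inord a) (inord b).
  have {}sym a b : f a b = f b a by exact: sym.
  have {}e1 : f 0%N 3%N = f 1%N 1%N by []. have {}e2 : f 0%N 4%N = f 1%N 2%N by [].
  have {}e3 : f 0%N 5%N = f 2%N 2%N by []. have {}e4 : f 1%N 4%N = f 2%N 3%N by [].
  have {}e5 : f 1%N 5%N = f 2%N 4%N by []. have {}e6 : f 3%N 5%N = f 4%N 4%N by [].
  have s01 := sym 0%N 1%N.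
  have s02 := sym 0%N 2%N.
  have s03 := sym 0%N 3%N.
  have s04 := sym 0%N 4%N.
  have s05 := sym 0%N 5%N.
  have s12 := sym 1%N 2%N.
  have s13 := sym 1%N 3%N.
  have s14 := sym 1%N 4%N.
  have s15 := sym 1%N 5%N.
  have s23 := sym 2%N 3%N.
  have s24 := sym 2%N 4%N.
  have s25 := sym 2%N 5%N.
  have s34 := sym 3%N 4%N.
  have s35 := sym 3%N 5%N.
  have s45 := sym 4%N 5%N.
  move=> i j k l; clear sym; rewrite /mono.
  apply: (_ : f _ _ = f _ _).
  by case: i j k l => [[|[|[|//]]] ?] [[|[|[|//]]] ?] [[|[|[|//]]] ?] [[|[|[|//]]] ?] /=;
    congruence.
have e1 := mA 0 0 1 1; have e2 := mA 0 0 1 2%:R; have e3 := mA 0 0 2%:R 2%:R.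
have e4 := mA 0 1 2%:R 1; have e5 := mA 0 1 2%:R 2%:R; have e6 := mA 1 1 2%:R 2%:R.
by split; split; [exact: e1 | exact: e2 | exact: e3 | exact: e4 | exact: e5 | exact: e6].
Qed.

Lemma coneCP (R : realType) (A : 'M[R]_6) : coneC A <-> psdmx A /\ moment A.
Proof.
by split=> -[psdA H]; split=> //; have [sA _] := (psdmxP A).1 psdA;
  apply/(moment_entries sA).
Qed.

Lemma moment_line (R : realType) (A B : 'M[R]_6) t :
  moment A -> moment B -> moment (A + t *: B).
Proof. by move=> mA mB i j k l; rewrite !mxE mA mB. Qed.

Lemma vE (R : realType) (P : 'I_3 -> R) i j :
  v (P 0) (P 1) (P 2%:R) (mono i j) 0 = P i * P j.
Proof.
rewrite mxE inordK; last by case: i j => [[|[|[|//]]] ?] [[|[|[|//]]] ?].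
have ord3 (k : 'I_3) : [\/ k = 0, k = 1 | k = 2%:R].
  by case: k => [[|[|[|//]]] ?];
    [apply: Or31 | apply: Or32 | apply: Or33]; apply: val_inj.
by case: (ord3 i) => ->; case: (ord3 j) => ->; rewrite /= ?expr2 // mulrC.
Qed.

Lemma moment_v (R : realType) (x y z : R) : moment (v x y z *m (v x y z)^T).
Proof.
pose P (i : 'I_3) := [:: x; y; z]`_i.
have -> : v x y z = v (P 0) (P 1) (P 2%:R) by [].
by move=> i j k l; rewrite !mxE !big_ord1 ![_^T _ _]mxE !vE; ring.
Qed.

(** * Multiplication of linear forms in a Gram representation *)

(** Read [Y : 'M_(6, r)] as the linear map from quadratic forms to [R^r] that
    sends a monomial to the corresponding row.  Then [mulform Y l] is the map
    [q |-> Y (l q)] on linear forms [q], and [mulvar Y i] is the case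
    [l = x_i]. *)
Definition mulvar (R : realType) r (Y : 'M[R]_(6, r)) (i : 'I_3) : 'M[R]_(3, r) :=
  \matrix_(j, a) Y (mono i j) a.

Definition mulform (R : realType) r (Y : 'M[R]_(6, r)) (l : 'rV[R]_3) : 'M[R]_(3, r) :=
  \sum_i l 0 i *: mulvar Y i.

Section GramRepresentation.
Variables (R : realType) (r : nat) (Y : 'M[R]_(6, r)).
Implicit Types (l m p q : 'rV[R]_3) (S : 'M[R]_r).

Local Notation tau := (mulvar Y).
Local Notation T := (mulform Y).

Lemma mulformE l j a : T l j a = \sum_i l 0 i * Y (mono i j) a.
Proof. by rewrite summxE; apply: eq_bigr => i _; rewrite !mxE. Qed.

Lemma mulformC l q : q *m T l = l *m T q.
Proof.
apply/rowP => a; rewrite !mxE.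
under eq_bigr => j _ do rewrite mulformE mulr_sumr.
under [RHS]eq_bigr => j _ do rewrite mulformE mulr_sumr.
rewrite exchange_big; apply: eq_bigr => i _; apply: eq_bigr => j _.
by rewrite monoC; ring.
Qed.

Lemma mulform_line l m t : T (l + t *: m) = T l + t *: T m.
Proof.
rewrite scaler_sumr -big_split; apply: eq_bigr => i _.
by rewrite !mxE scalerDl scalerA.
Qed.

Lemma mulform_delta i : T (delta_mx 0 i) = tau i.
Proof.
rewrite /mulform (bigD1 i) //= mxE !eqxx scale1r big1 ?addr0 // => j /negbTE ji.
by rewrite mxE ji andbF scale0r.
Qed.

Lemma mulvar_row i j : row j (tau i) = row (mono i j) Y.
Proof. by apply/rowP => a; rewrite !mxE. Qed.

Lemma momentP S :
  moment (Y *m S *m Y^T) <->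
  forall i k, tau i *m S *m (tau k)^T = tau k *m S *m (tau i)^T.
Proof.
have E i j k h : (tau i *m S *m (tau k)^T) j h =
    (Y *m S *m Y^T) (mono i j) (mono k h).
  rewrite !mxE; apply: eq_bigr => a _; rewrite !mxE; congr (_ * _).
  by apply: eq_bigr => b _; rewrite !mxE.
split=> [mS i k|H i j k h].
  by apply/matrixP => j h; rewrite !E monoC mS (monoC j) -mS.
by rewrite (monoC i) -E H E (monoC k).
Qed.

Lemma mulformM S l m : moment (Y *m S *m Y^T) ->
  T l *m S *m (T m)^T = T m *m S *m (T l)^T.
Proof.
move=> /momentP H.
have trT q : (T q)^T = \sum_i q 0 i *: (tau i)^T.
  by rewrite [LHS]linear_sum; apply: eq_bigr => i _; rewrite linearZ.
have E q q' : T q *m S *m (T q')^T =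
    \sum_i \sum_j (q 0 i * q' 0 j) *: (tau i *m S *m (tau j)^T).
  rewrite trT !mulmx_suml; apply: eq_bigr => i _.
  rewrite mulmx_sumr; apply: eq_bigr => j _.
  by rewrite -scalemxAr -!scalemxAl scalerA mulrC.
rewrite !E exchange_big; apply: eq_bigr => i _; apply: eq_bigr => j _.
by rewrite H mulrC.
Qed.

End GramRepresentation.

(** * Points in the range of a moment matrix *)

Lemma sym_rank1 (R : realType) n (F : 'M[R]_n) :
  F^T = F -> F != 0 -> (\rank F <= 1)%N ->
  exists c (P : 'I_n -> R), c != 0 /\ forall i j, F i j = c * (P i * P j).
Proof.
move=> sF /matrix0Pn [k [m Fkm]] rF.
have nz : row k F != 0.
  by apply: contraNneq Fkm => /rowP /(_ m); rewrite !mxE => ->.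
have sub : (F <= row k F)%MS.
  rewrite -(geq_leqif (mxrank_leqif_sup (row_sub k F))) rank_rV nz //.
have /submxP [D FD] := sub.
have FE i j : F i j = D i 0 * F k j.
  by rewrite [in LHS]FD mxE big_ord1 mxE.
have sFE i j : F i j = F j i by rewrite -[in LHS]sF mxE.
have DE i : D i 0 = D m 0 / F k m * F k i.
  apply: (mulIf Fkm); rewrite -FE mulrAC divfK // -FE; exact: sFE.
exists (D m 0 / F k m), (F k); split=> [|i j]; last by rewrite FE DE mulrA.
by apply: contraNneq Fkm => E; rewrite FE DE E !mul0r.
Qed.

Section PointInRange.
Variables (R : realType) (r : nat) (Y : 'M[R]_(6, r)).
Hypotheses (fullY : row_full Y) (momY : moment (Y *m Y^T)).
Implicit Types (l m p q : 'rV[R]_3) (y : 'cV[R]_r).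

Local Notation tau := (mulvar Y).
Local Notation T := (mulform Y).

Lemma row_full_inj y : Y *m y = 0 -> y = 0.
Proof.
move=> Yy; have [Q QY] := row_fullP fullY.
by rewrite -[y]mul1mx -QY -mulmxA Yy mulmx0.
Qed.

Lemma mulform_gramC l m : T l *m (T m)^T = T m *m (T l)^T.
Proof. by have := @mulformM _ _ Y 1%:M l m; rewrite !mulmx1; apply. Qed.

Lemma mulvar_gramC i j : tau i *m (tau j)^T = tau j *m (tau i)^T.
Proof. by rewrite -!mulform_delta mulform_gramC. Qed.

Lemma mulvar_col i j y : (tau i *m y) j 0 = (Y *m y) (mono i j) 0.
Proof. by rewrite !mxE; apply: eq_bigr => a _; rewrite mxE. Qed.

(** The vectors [v(P)] in the range are detected on the [3 x 3] matrix of the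
    values at the products [x_i x_j]. *)
Lemma point_of_rank1 y c (P : 'I_3 -> R) : c != 0 ->
  (forall i j, (tau i *m y) j 0 = c * (P i * P j)) ->
  v (P 0) (P 1) (P 2%:R) = Y *m (c^-1 *: y).
Proof.
move=> c0 H; apply/colP => k; have [i [j ->]] := mono_surj k.
by rewrite vE -scalemxAr mxE -mulvar_col H mulKf.
Qed.

(** If [Y (l q)] exhausts [R^r] as [q] varies, then [Y (l q) |-> Y (x_i q)] is
    a well defined endomorphism [M i].  The [M i] are symmetric and commute
    since all [<Y (f), Y (g)>] only depend on the product [f g]; for the same
    reason [Y (M i) Y^T] is again a moment matrix.  When this forces the [M i]
    to be scalars [lam i], every [Y (x_i x_j)] is [lam i * lam j] times a fixed
    vector. *)
Lemma flat_point l : (0 < r)%N ->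
  (forall S, S^T = S -> moment (Y *m S *m Y^T) -> exists s, S = s%:M) ->
  row_full (T l) ->
  exists (P : 'I_3 -> R) y, y != 0 /\ v (P 0) (P 1) (P 2%:R) = Y *m y.
Proof.
move=> r0 rigid /row_fullP [Q QT].
have cancl (A B : 'M_r) : T l *m A = T l *m B -> A = B.
  by move=> E; rewrite -[A]mul1mx -[B]mul1mx -QT -!mulmxA E.
have cancr n (A B : 'M_(n, r)) : A *m (T l)^T = B *m (T l)^T -> A = B.
  move=> E; have {}QT : (T l)^T *m Q^T = 1%:M by rewrite -trmx_mul QT trmx1.
  by rewrite -[A]mulmx1 -[B]mulmx1 -QT !mulmxA E.
pose M i := Q *m tau i.
have gramT i : T l *m (tau i)^T = tau i *m (T l)^T.
  by rewrite -mulform_delta mulform_gramC.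
have TM i : T l *m M i = tau i.
  by apply: cancr; rewrite -!mulmxA -gramT (mulmxA Q) QT mul1mx.
clearbody M.
have symM k : (M k)^T = M k.
  apply: cancl; apply: cancr.
  by rewrite TM -mulmxA -trmx_mul TM gramT.
have TMt i : M i *m (T l)^T = (tau i)^T by rewrite -[M i]symM -trmx_mul TM.
have commM i k : M i *m M k = M k *m M i.
  apply: cancl; apply: cancr.
  by rewrite !mulmxA !TM -!mulmxA !TMt mulvar_gramC.
have momM k : moment (Y *m M k *m Y^T).
  apply/momentP => i j; rewrite -[in LHS]TM -[in RHS]TM -!TMt.
  rewrite -!mulmxA; congr (_ *m _); rewrite !mulmxA; congr (_ *m _).
  by rewrite -[LHS]mulmxA (commM k j) [LHS]mulmxA (commM i j) -[LHS]mulmxA (commM i k) mulmxA.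
have [lam lamE] := choice (fun i => rigid (M i) (symM i) (momM i)).
have tauE i : tau i = lam i *: T l by rewrite -TM lamE mul_mx_scalar.
pose w := l *m T l.
have rowE i j : row (mono i j) Y = (lam i * lam j) *: w.
  rewrite -mulvar_row tauE linearZ /= rowE mulformC mulform_delta tauE.
  by rewrite -scalemxAr scalerA.
have w0 : w != 0.
  apply/eqP => w0; have Y0 : Y = 0.
    apply/row_matrixP => k; have [i [j ->]] := mono_surj k.
    by rewrite rowE w0 scaler0 row0.
  by move: fullY; rewrite /row_full Y0 mxrank0 eq_sym -leqn0 leqNgt r0.
have c0 : (w *m w^T) 0 0 != 0.
  by rewrite -[w in w *m _]trmxK sqnorm_eq0 trmx_eq0.
have := @point_of_rank1 w^T _ lam c0 _; set c := (w *m w^T) 0 0 in c0 * => H.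
exists lam, (c^-1 *: w^T); split.
  by rewrite scaler_eq0 invr_eq0 negb_or c0 trmx_eq0.
apply: H => i j; rewrite mulvar_col.
have -> : (Y *m w^T) (mono i j) 0 = (row (mono i j) Y *m w^T) 0 0.
  by rewrite -row_mul [RHS]mxE.
by rewrite rowE -scalemxAl mxE mulrC.
Qed.

(** If [Y (p q) = 0] for all [q], take [l] independent of [p] and [y]
    orthogonal to all [Y (l q)]: the quadratic functional [y^T Y] kills the
    multiples of [l] and of [p], hence is a multiple of the evaluation at the
    common zero of [l] and [p]. *)
Lemma degenerate_point p : (0 < r)%N ->
  (forall S, S^T = S -> moment (Y *m S *m Y^T) -> exists s, S = s%:M) ->
  p != 0 -> T p = 0 ->
  exists (P : 'I_3 -> R) y, y != 0 /\ v (P 0) (P 1) (P 2%:R) = Y *m y.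
Proof.
move=> r0 rigid p0 Tp.
have [l lp] : exists l, ~~ (l <= p)%MS.
  apply: contrapT => no; have : (1%:M <= p)%MS.
    apply/row_subP => j; apply: contrapT => nj; apply: no.
    by exists (row j 1%:M); apply/negP.
  by move/mxrankS; rewrite mxrank1 leqNgt ltnS (leq_trans (rank_leq_row _)).
have [full|nfull] := boolP (row_full (T l)); first exact: flat_point full.
have : kermx (T l)^T != 0.
  by rewrite kermx_eq0 /row_free mxrank_tr.
move=> /rowV0Pn [u /sub_kermxP uT u0]; pose y := u^T.
have Ty : T l *m y = 0 by rewrite -[T l]trmxK -trmx_mul uT trmx0.
have y0 : y != 0 by rewrite trmx_eq0.
pose F := \matrix_(i, j) (tau i *m y) j 0.
have kill q : T q *m y = 0 -> q *m F = 0.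
  move=> Tq; apply/rowP => j; rewrite [RHS]mxE.
  transitivity ((T q *m y) j 0); last by rewrite Tq mxE.
  rewrite mulmx_suml summxE mxE; apply: eq_bigr => i _.
  by rewrite -scalemxAl !mxE.
have sF : F^T = F.
  by apply/matrixP => i j; rewrite mxE [LHS]mxE [RHS]mxE !mulvar_col monoC.
have F0 : F != 0.
  apply: contraNneq y0 => F0; apply/eqP; apply: row_full_inj; apply/colP => k.
  have [i [j ->]] := mono_surj k; rewrite -mulvar_col [RHS]mxE.
  by have /matrixP /(_ i j) := F0; rewrite !mxE.
have rF : (\rank F <= 1)%N.
  have freelp : row_free (col_mx p l).
    by apply: row_free_col_mx => //; rewrite /row_free rank_rV p0.
  have : col_mx p l *m F = 0.
    by rewrite mul_col_mx (kill l) // (kill p) ?col_mx0 // Tp mul0mx.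
  by move/mulmx0_rank_max; rewrite (eqP freelp).
have [c [P [c0 FE]]] := sym_rank1 sF F0 rF.
exists P, (c^-1 *: y); split; first by rewrite scaler_eq0 invr_eq0 negb_or c0.
by apply: point_of_rank1 => // i j; rewrite -FE [RHS]mxE.
Qed.

(** Suppose [Y (l p) = 0] and [y = Y (m p) != 0].  Then [y] is orthogonal to
    all [Y (l q)], as [<Y (m p), Y (l q)> = <Y (l p), Y (m q)>], so that [y]
    is independent of the range of [T l].  Since [T (l + e m)] sends [p] to
    [e y], its rank exceeds that of [T l] for suitable [e != 0]. *)
Lemma mulform_rank_increase l : (forall p, T p = 0 -> p = 0) ->
  ~~ row_free (T l) -> exists l', (\rank (T l) < \rank (T l'))%N.
Proof.
move=> inj; rewrite -kermx_eq0 => /rowV0Pn [p /sub_kermxP pT p0].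
have [m mT] : exists m, m *m T p != 0.
  apply: contrapT => no; case/eqP: p0; apply: inj; apply/row_matrixP => i.
  rewrite row0 rowE; apply/eqP; apply: contrapT => ?; apply: no.
  by exists (delta_mx 0 i); apply/negP.
pose y := p *m T m; have yE : y != 0 by rewrite /y mulformC.
have yT : T l *m y^T = 0.
  rewrite -[T l]trmxK -trmx_mul -mulmxA mulform_gramC mulmxA pT mul0mx.
  by rewrite trmx0.
have /submxP [W WE] : (row_base (T l) <= T l)%MS by rewrite eq_row_base.
have free : row_free (col_mx (row_base (T l)) y).
  apply: row_free_col_mx; first exact: row_base_free.
  apply/negP => /submxP [D yD]; case/eqP: yE; apply/eqP.
  rewrite -trmx_eq0 -sqnorm_eq0 trmxK {1}yD WE -!mulmxA yT !mulmx0 mxE.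
  exact: eqxx.
have [e e0 free'] := row_free_perturb (col_mx (W *m T m) 0) free.
exists (l + e *: m).
have E : col_mx (row_base (T l)) y + e *: col_mx (W *m T m) 0 =
    col_mx W (e^-1 *: p) *m T (l + e *: m).
  rewrite scale_col_mx add_col_mx scaler0 addr0 mulform_line mul_col_mx.
  congr col_mx; first by rewrite WE mulmxDr -scalemxAr.
  by rewrite -scalemxAl mulmxDr pT add0r -scalemxAr scalerA mulVf // scale1r.
move: free'; rewrite E => /eqP rk.
by rewrite -addn1 -[leqLHS]rk mxrankM_maxr.
Qed.

Lemma mulform_free : (forall p, T p = 0 -> p = 0) -> exists l, row_free (T l).
Proof.
move=> inj; apply: contrapT => no.
have big k : exists l, (k <= \rank (T l))%N.
  elim: k => [|k [l kl]]; first by exists 0.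
  have [|l' ll'] := @mulform_rank_increase l inj; last by exists l'; exact: leq_ltn_trans ll'.
  by apply/negP => ?; apply: no; exists l.
by have [l] := big 4; rewrite leqNgt ltnS rank_leq_row.
Qed.

End PointInRange.

(** * Reduction of the rank *)

Lemma kernel_nonzero (R : realType) m n p (f : {linear 'M[R]_(m, n) -> 'rV[R]_p}) :
  (p < m * n)%N -> exists2 S, S != 0 & f S = 0.
Proof.
move=> lt; have : kermx (lin_mx f) != 0.
  rewrite kermx_eq0 /row_free; apply: contraL lt => /eqP <-.
  by rewrite -leqNgt -[leqRHS]mul1n rank_leq_col.
move=> /rowV0Pn [u /sub_kermxP uf u0]; exists (vec_mx u).
  by rewrite -mxvec_eq0 vec_mxK.
by apply: (can_inj mxvecK); rewrite -mul_vec_lin vec_mxK uf linear0.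
Qed.

(** The 16 entries of [S] are subject to 6 linear conditions for symmetry, 6
    for the equations of a moment matrix and 1 for the trace; as 13 < 16, a
    nonzero solution exists.  The same count fails for [3 x 3] matrices. *)
Lemma moment_sandwich4 (R : realType) (Z : 'M[R]_(6, 4)) :
  exists S : 'M[R]_4,
    [/\ S^T = S, S != 0, \tr S = 0 & moment (Z *m S *m Z^T)].
Proof.
pose B (S : 'M[R]_4) := Z *m S *m Z^T.
pose f (S : 'M[R]_4) : 'rV[R]_13 := \row_(k < 13)
  [:: S (inord 0) (inord 1) - S (inord 1) (inord 0);
      S (inord 0) (inord 2) - S (inord 2) (inord 0);
      S (inord 0) (inord 3) - S (inord 3) (inord 0);
      S (inord 1) (inord 2) - S (inord 2) (inord 1);
      S (inord 1) (inord 3) - S (inord 3) (inord 1);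
      S (inord 2) (inord 3) - S (inord 3) (inord 2);
      entry (B S) 1 4 - entry (B S) 2 2;
      entry (B S) 1 5 - entry (B S) 2 3;
      entry (B S) 1 6 - entry (B S) 3 3;
      entry (B S) 2 5 - entry (B S) 3 4;
      entry (B S) 2 6 - entry (B S) 3 5;
      entry (B S) 4 6 - entry (B S) 5 5;
      \tr S]`_k.
have lin_f : linear f.
  move=> a S S'; have BE : B (a *: S + S') = a *: B S + B S'.
    by rewrite /B mulmxDr mulmxDl -scalemxAr -scalemxAl.
  have eE C C' i j : entry (a *: C + C' : 'M[R]_6) i j = a * entry C i j + entry C' i j.
    by rewrite /entry !mxE.
  apply/rowP => -[k lt]; rewrite !mxE BE !eE mxtraceD mxtraceZ /=.
  by do 13 (case: k lt => [|k] lt /=; first by ring).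
pose F : {linear 'M[R]_4 -> 'rV[R]_13} :=
  HB.pack f (GRing.isLinear.Build _ _ _ _ f lin_f).
have [S S0 FS] := @kernel_nonzero R 4 4 13 F isT.
have z k (lt : (k < 13)%N) : f S 0 (Ordinal lt) = 0.
  by rewrite -[f S]/(F S) FS mxE.
have := (z 0 isT, z 1 isT, z 2 isT, z 3 isT, z 4 isT, z 5 isT)%N.
have := (z 6 isT, z 7 isT, z 8 isT, z 9 isT, z 10 isT, z 11 isT)%N.
have := z 12%N isT.
rewrite !mxE /= => trS.
move=> [[[[[/subr0_eq m1 /subr0_eq m2] /subr0_eq m3] /subr0_eq m4] /subr0_eq m5] /subr0_eq m6].
move=> [[[[[/subr0_eq s1 /subr0_eq s2] /subr0_eq s3] /subr0_eq s4] /subr0_eq s5] /subr0_eq s6].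
have sS : S^T = S.
  apply/matrixP => i j; rewrite mxE -(inord_val i) -(inord_val j).
  by case: i j => [[|[|[|[|//]]]] ?] [[|[|[|[|//]]]] ?].
exists S; split=> //; apply/moment_entries; last by [].
by rewrite !trmx_mul trmxK sS mulmxA.
Qed.

Lemma moment_sandwich (R : realType) r (Y : 'M[R]_(6, r)) : (4 <= r)%N ->
  exists S : 'M[R]_r,
    [/\ S^T = S, S != 0, \tr S = 0 & moment (Y *m S *m Y^T)].
Proof.
move=> r4; pose P : 'M[R]_(r, 4) := pid_mx 4.
have PP : P^T *m P = 1%:M.
  by rewrite tr_pid_mx mul_pid_mx minnn (minn_idPr r4) pid_mx_1.
have [S [sS S0 trS mS]] := moment_sandwich4 (Y *m P).
exists (P *m S *m P^T); split.
- by rewrite !trmx_mul trmxK sS mulmxA.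
- apply: contraNneq S0 => PS; apply/eqP.
  have : P^T *m (P *m S *m P^T) *m P = 0 by rewrite PS mulmx0 mul0mx.
  by rewrite !mulmxA PP mul1mx -mulmxA PP mulmx1.
- by rewrite mxtrace_mulC mulmxA PP mul1mx.
- by move: mS; rewrite trmx_mul !mulmxA.
Qed.

Definition has_point (R : realType) (A : 'M[R]_6) :=
  exists (P : 'I_3 -> R),
    v (P 0) (P 1) (P 2%:R) != 0 /\ ((v (P 0) (P 1) (P 2%:R))^T <= A)%MS.

Lemma gram_row_space (R : realType) r (Y : 'M[R]_(6, r)) :
  row_full Y -> (Y^T <= Y *m Y^T)%MS.
Proof.
by move=> /row_fullP [Q QY]; apply/submxP; exists Q; rewrite mulmxA QY mul1mx.
Qed.

Lemma rank_gram (R : realType) r (Y : 'M[R]_(6, r)) :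
  row_full Y -> (r <= \rank (Y *m Y^T))%N.
Proof.
move=> fullY; rewrite -[leqLHS](eqP fullY) -mxrank_tr mxrankS //.
exact: gram_row_space.
Qed.

Lemma rank_sandwich_lt (R : realType) r (Y : 'M[R]_(6, r)) (M : 'M[R]_r) :
  row_full Y -> M \notin unitmx ->
  (\rank (Y *m M *m Y^T) < \rank (Y *m Y^T))%N.
Proof.
move=> fullY nuM; apply: leq_trans (rank_gram fullY).
apply: (@leq_ltn_trans (\rank M)).
  by apply: leq_trans (mxrankM_maxl _ _) _; exact: mxrankM_maxr.
by rewrite ltn_neqAle rank_leq_row andbT; move: nuM; rewrite -row_free_unit.
Qed.

(** The case in which the rank cannot be lowered inside the range of
    [Y Y^T]. *)
Lemma has_point_rigid (R : realType) r (Y : 'M[R]_(6, r)) :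
  (0 < r)%N -> row_full Y -> moment (Y *m Y^T) ->
  (forall S : 'M[R]_r, S^T = S -> \tr S = 0 -> moment (Y *m S *m Y^T) -> S = 0) ->
  has_point (Y *m Y^T).
Proof.
move=> r0 fullY momY rigid0.
have rigid (S : 'M_r) : S^T = S -> moment (Y *m S *m Y^T) -> exists s, S = s%:M.
  (* Subtracting its mean eigenvalue makes S traceless. *)
  move=> sS mS; pose s := \tr S / r%:R; exists s.
  apply/eqP; rewrite -subr_eq0; apply/eqP/rigid0.
  - by rewrite raddfB /= sS tr_scalar_mx.
  - by rewrite raddfB /= mxtrace_scalar -mulr_natr divfK ?subrr // pnatr_eq0 -lt0n.
  - have -> : Y *m (S - s%:M) *m Y^T = Y *m S *m Y^T + (- s) *: (Y *m Y^T).
      by rewrite mulmxBr mulmxBl mul_mx_scalar -scalemxAl scaleNr.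
    exact: moment_line.
have [P [y [y0 vy]]] :
    exists (P : 'I_3 -> R) (y : 'cV_r), y != 0 /\ v (P 0) (P 1) (P 2%:R) = Y *m y.
  have [[p p0 Tp]|no] := pselect (exists2 p, p != 0 & mulform Y p = 0).
    exact: degenerate_point Tp.
  have [p Tp|l freel] := mulform_free momY.
    by apply/eqP/negP => /negP p0; apply: no; exists p.
  have r3 : r = 3.
    apply/eqP; rewrite eqn_leq; apply/andP; split.
      rewrite leqNgt; apply/negP => /(moment_sandwich Y) [S [sS S0 trS mS]].
      by case/eqP: S0; exact: rigid0.
    by have := rank_leq_col (mulform Y l); rewrite (eqP freel).
  by apply: (@flat_point _ _ _ fullY momY l) => //; rewrite /row_full (eqP freel) r3.
exists P; split.
  rewrite vy; apply: contraNneq y0 => Yy; apply/eqP; exact: row_full_inj Yy.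
by rewrite vy trmx_mul; apply: submx_trans (gram_row_space fullY); exact: submxMl.
Qed.

Lemma coneC_has_point (R : realType) (A : 'M[R]_6) :
  coneC A -> A != 0 -> has_point A.
Proof.
elim: {A}(\rank A).+1 {-2}A (ltnSn (\rank A)) => // k IHk A rkA CA A0.
have [psdA mA] := (coneCP A).1 CA.
have [r [Y [fullY AE]]] := gram_factor psdA.
have r0 : (0 < r)%N.
  rewrite lt0n; apply: contraNneq A0 => r0; rewrite AE.
  by apply/eqP/matrixP => i j; rewrite mxE big1 ?mxE // => -[a lt]; have := leq_trans lt (eq_leq r0).
have YA := gram_row_space fullY; rewrite -AE in YA.
have [[S [sS S0 trS mS]]|no] := pselect (exists S : 'M[R]_r,
    [/\ S^T = S, S != 0, \tr S = 0 & moment (Y *m S *m Y^T)]); last first.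
  rewrite AE; apply: has_point_rigid => //; first by rewrite -AE.
  by move=> S sS trS mS; apply/eqP/negP => /negP S0; apply: no; exists S.
have [t psdM nuM] := psdmx_exit sS S0 trS.
set M := _ + _ in psdM nuM; pose A' := Y *m M *m Y^T.
have A'E : A' = A + t *: (Y *m S *m Y^T).
  by rewrite /A' mulmxDr mulmxDl mulmx1 -AE -scalemxAr -scalemxAl.
have CA' : coneC A'.
  apply/coneCP; split; first exact: psdmx_congr.
  by rewrite A'E; exact: moment_line.
have A'0 : A' != 0.
  have [Q QY] := row_fullP fullY.
  apply/eqP => A'0; have : \tr (Q *m A' *m Q^T) = r%:R.
    rewrite /A' !mulmxA QY mul1mx -mulmxA -trmx_mul QY trmx1 mulmx1.
    by rewrite mxtraceD mxtraceZ trS mulr0 addr0 mxtrace1.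
  rewrite A'0 mulmx0 mul0mx mxtrace0 => /esym/eqP.
  by rewrite pnatr_eq0 -leqn0 leqNgt r0.
have rkA' : (\rank A' < \rank A)%N.
  by rewrite [in ltnRHS]AE; exact: rank_sandwich_lt.
have [P [vP sub]] := IHk A' (leq_trans rkA' rkA) CA' A'0.
exists P; split=> //; apply: submx_trans sub _.
by apply: submx_trans YA; exact: submxMl.
Qed.

Lemma coneC_v (R : realType) (x y z : R) : coneC (v x y z *m (v x y z)^T).
Proof.
apply/coneCP; split; last exact: moment_v.
by have := psdmx_congr (v x y z) (psdmx1 R 1); rewrite mulmx1.
Qed.

(** If [v = Y y] with [A = Y Y^T], then
    [A - v v^T / |y|^2 = Y (1 - y y^T / |y|^2) Y^T] involves the projection
    orthogonal to [y]. *)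
Lemma coneC_subtract_point (R : realType) (A : 'M[R]_6) : coneC A -> A != 0 ->
  exists x y z t : R, [/\ v x y z != 0, 0 < t,
    coneC (A - t *: (v x y z *m (v x y z)^T)) &
    (\rank (A - t *: (v x y z *m (v x y z)^T))%R < \rank A)%N].
Proof.
move=> CA A0; have [P [v0 vA]] := coneC_has_point CA A0.
exists (P 0), (P 1), (P 2%:R); set V := v _ _ _ in v0 vA *.
have [psdA mA] := (coneCP A).1 CA.
have [r [Y [fullY AE]]] := gram_factor psdA.
have YA := gram_row_space fullY; rewrite -AE in YA.
have [y VE] : exists y : 'cV_r, V = Y *m y.
  have : (V^T <= Y^T)%MS by apply: submx_trans vA _; rewrite AE submxMl.
  by move=> /submxP [D VD]; exists D^T; rewrite -[V]trmxK VD trmx_mul trmxK.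
have y0 : y != 0 by apply: contraNneq v0 => y0; rewrite VE y0 mulmx0.
pose t := ((y^T *m y) 0 0)^-1; exists t.
have q0 : 0 < (y^T *m y) 0 0 by rewrite sqnorm_gt0.
have t0 : 0 < t by rewrite invr_gt0.
have yy : y^T *m y = t^-1%:M by rewrite invrK -mx11_scalar.
pose N := 1%:M - t *: (y *m y^T).
have NT : N^T = N by rewrite raddfB /= trmx1 linearZ /= trmx_mul trmxK.
have Ny : N *m y = 0.
  rewrite mulmxBl mul1mx -scalemxAl -mulmxA yy mul_mx_scalar scalerA.
  by rewrite divff ?gt_eqF // scale1r subrr.
have NN : N *m N^T = N.
  rewrite NT {2}/N mulmxBr mulmx1 -scalemxAr mulmxA Ny mul0mx scaler0 subr0 //.
have A'E : A - t *: (V *m V^T) = Y *m N *m Y^T.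
  rewrite mulmxBr mulmxBl mulmx1 -AE -scalemxAr -scalemxAl VE trmx_mul.
  by rewrite !mulmxA.
split=> //.
- apply/coneCP; split; last first.
    by rewrite -scaleNr; apply: moment_line => //; exact: moment_v.
  rewrite A'E; apply: psdmx_congr; rewrite -NN.
  by have := psdmx_congr N (psdmx1 R r); rewrite mulmx1.
- rewrite A'E [in ltnRHS]AE; apply: rank_sandwich_lt => //.
  by apply: contra y0 => uN; rewrite -(mulKmx uN y) Ny mulmx0.
Qed.

(** * Extreme rays and decompositions *)

Theorem theorem1 (R : realType) :
  (forall r : set 'M[R]_6, extreme_ray (@coneC R) r ->
     exists x y z : R,
       \rank (v x y z *m (v x y z)^T) = 1%N /\
       r = ray (v x y z *m (v x y z)^T)) /\
  (forall A : 'M[R]_6, coneC A ->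
     exists (n : nat) (c x y z : 'I_n -> R),
       (forall i, 0 <= c i) /\
       A = \sum_(i < n) c i *: (v (x i) (y i) (z i) *m (v (x i) (y i) (z i))^T)).
Proof.
split=> [r ext|A].
  have [[A [CA A0 rA]] _] := ext; subst r.
  have [x [y [z [t [v0 t0 CB _]]]]] := coneC_subtract_point CA A0.
  set V := v x y z in v0 CB.
  have CtV : coneC (t *: (V *m V^T)).
    by apply: (coneC_convex R).2; [exact: ltW | exact: coneC_v].
  have [two _] := extreme_rayP (coneC_convex R) (@coneC_pointed R) CA A0.
  have [|[s s0 sE] _] := two ext _ _ CtV CB; first by rewrite addrC subrK.
  have VV0 : V *m V^T != 0.
    by apply: contraNneq v0 => VV; apply/eqP/mxtrace_gram; rewrite VV mxtrace0.
  exists x, y, z; split.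
    apply/eqP; rewrite eqn_leq lt0n mxrank_eq0 VV0 andbT.
    by apply: leq_trans (mxrankM_maxl _ _) (rank_leq_col _).
  rewrite -/V -(ray_scale (V *m V^T) t0) sE ray_scale // lt_neqAle s0 andbT eq_sym.
  apply: contraNneq VV0 => s00; move/eqP: sE.
  by rewrite s00 scale0r scaler_eq0 (gt_eqF t0).
elim: {A}(\rank A).+1 {-2}A (ltnSn (\rank A)) => // k IHk A rkA CA.
have [->|A0] := eqVneq A 0.
  by exists 0%N, (fun=> 0), (fun=> 0), (fun=> 0), (fun=> 0); rewrite big_ord0; split.
have [x [y [z [t [v0 t0 CB rkB]]]]] := coneC_subtract_point CA A0.
have [n [c [xs [ys [zs [c0 BE]]]]]] := IHk _ (leq_trans rkB rkA) CB.
pose cons a (f : 'I_n -> R) i := oapp f a (unlift ord0 i).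
exists n.+1, (cons t c), (cons x xs), (cons y ys), (cons z zs); split.
  by move=> i; rewrite /cons; case: unliftP => [j|] _ //=; exact: ltW.
rewrite big_ord_recl /cons unlift_none /=.
under eq_bigr => i _ do rewrite liftK /=.
by rewrite -BE addrC subrK.
Qed.
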